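(* Let $E$ be an Archimedean vector lattice with the principal projection property, let $F$ be a Dedekind complete vector lattice, let $\Phi:\mathfrak{B}(E)\to\mathfrak{B}(F)$ be a Boolean homomorphism, let $D$ be a lateral ideal in $E$, and let $T:D\to F$ be an atomic (subordinate to $\Phi$), positive, orthogonally additive map. Then the minimal extension $\widetilde{T}_D:E\to F$ of $T$, given by $$\widetilde{T}_Dx=\sup\{Ty:\ y\in\mathcal{F}_x\cap D\}\qquad(x\in E),$$ is an atomic (subordinate to $\Phi$), positive, orthogonally additive operator from $E$ to $F$ as well.
   Context: All vector lattices are real and Archimedean. Two elements $x,y$ of a vector lattice are disjoint ($x\perp y$) if $|x|\wedge|y|=0$. An element $y\in E$ is a fragment of $x\in E$ if $y\perp(x-y)$; $\mathcal{F}_x$ denotes the set of all fragments of $x$. An order projection on $E$ is a positive linear projection $\pi:E\to E$ with $0\le\pi\le Id$. The set $\mathfrak{B}(E)$ of all order projections is a Boolean algebra with $\pi\wedge\rho=\pi\circ\rho$, $\pi\vee\rho=\pi+\rho-\pi\circ\rho$, $\overline{\pi}=Id-\pi$. $E$ has the principal projection property if for every $x\in E$ the band generated by $x$ is a projection band. A Boolean homomorphism is a map between Boolean algebras preserving $\vee$, $\wedge$ and complements. A subset $D\subseteq E$ is a lateral ideal if (i) $x\in D$ and $y\in\mathcal{F}_x$ imply $y\in D$; (ii) $x,y\in D$ and $x\perp y$ imply $x+y\in D$. For a lateral ideal $D$ (the case $D=E$ included), a (possibly nonlinear) map $T:D\to F$ is: orthogonally additive if $T(x+y)=Tx+Ty$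 for all disjoint $x,y\in D$; positive if $Tx\ge0$ for all $x\in D$; atomic (subordinate to $\Phi$) if $T(\pi x)=\Phi(\pi)Tx$ for every $\pi\in\mathfrak{B}(E)$ and $x\in D$ (note that $\pi x\in\mathcal{F}_x\subseteq D$). The minimal extension of a positive orthogonally additive map $T:D\to F$ is the operator $\widetilde{T}_D:E\to F$ defined by the displayed supremum formula, with the convention $\sup\emptyset=0$.
   Formalization: It is additionally assumed that for every x in E the set {Ty : y in F_x ∩ D} is order bounded above in F, i.e. that all suprema in the formula exist; this can fail, e.g. E=R^N, F=l^infty, D the finitely supported sequences, Ty=(n|y_n|). *)

(* Defs.v *)
From HB Require Import structures.
From mathcomp Require Import all_boot all_order all_algebra.
From mathcomp Require Import boolp classical_sets reals.

Set Implicit Arguments.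
Unset Strict Implicit.
Unset Printing Implicit Defensive.

Import Order.TTheory GRing.Theory Num.Theory.
Local Open Scope classical_set_scope.
Local Open Scope ring_scope.

(* The lattice operations are fields, not those of [Order.Lattice]: no structure
   of the library joins lattices and additive groups below [realDomainType], and
   Hierarchy-Builder does not let one be added. *)
HB.mixin Record Lmodule_POrder_isVectorLattice (R : realType) E
    of GRing.Lmodule R E & Order.POrder ring_display E := {
  vl_join : E -> E -> E;
  vl_meet : E -> E -> E;
  vl_leUx : forall x y z : E, (vl_join x y <= z) = (x <= z) && (y <= z);
  vl_lexI : forall x y z : E, (z <= vl_meet x y) = (z <= x) && (z <= y);
  vl_leD2r : forall x y z : E, x <= y -> x + z <= y + z;
  vl_scale_ge0 : forall (a : R) (x : E), 0 <= a -> 0 <= x -> 0 <= a *: x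
}.

#[short(type="vectorLatticeType")]
HB.structure Definition VectorLattice (R : realType) :=
  { E of GRing.Lmodule R E & Order.POrder ring_display E
       & Lmodule_POrder_isVectorLattice R E }.

Section VectorLatticeNotions.
Variables (R : realType) (E : vectorLatticeType R).
Implicit Types (x y z : E) (A B D : set E).

Definition vl_abs x : E := vl_join x (- x).

Definition disjoint_elts x y : Prop := vl_meet (vl_abs x) (vl_abs y) = 0.

Definition fragments x : set E := [set y | disjoint_elts y (x - y)].

Definition vl_archimedean : Prop :=
  forall x y, 0 <= x -> (forall n : nat, x *+ n <= y) -> x = 0.

Definition dedekind_complete : Prop :=
  forall A, A !=set0 -> has_ubound A -> supremums A !=set0.

Definition vl_ideal A : Prop :=
  [/\ A 0,
      forall x y, A x -> A y -> A (x + y),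
      forall (a : R) x, A x -> A (a *: x) &
      forall x y, A x -> vl_abs y <= vl_abs x -> A y].

Definition band B : Prop :=
  vl_ideal B /\ forall A x, A `<=` B -> supremums A x -> B x.

Definition band_generated x : set E :=
  \bigcap_(B in [set B | band B /\ B x]) B.

Definition disjoint_complement B : set E :=
  [set y | forall x, B x -> disjoint_elts y x].

Definition projection_band B : Prop :=
  band B /\
  forall x, exists y z, [/\ B y, disjoint_complement B z & x = y + z].

Definition principal_projection_property : Prop :=
  forall x, projection_band (band_generated x).

Definition lateral_ideal D : Prop :=
  (forall x y, D x -> fragments x y -> D y) /\
  (forall x y, D x -> D y -> disjoint_elts x y -> D (x + y)).

End VectorLatticeNotions.

Arguments vl_archimedean {R} E.
Arguments dedekind_complete {R} E.
Arguments principal_projection_property {R} E.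

Section OrderProjections.
Variables (R : realType) (E : vectorLatticeType R).

Definition is_order_projection (f : E -> E) : Prop :=
  [/\ linear f, forall x, f (f x) = f x & forall x, 0 <= x -> 0 <= f x <= x].

(* By proof irrelevance and functional extensionality, Leibniz equality of
   order projections is pointwise equality. *)
Record order_projection := OrderProjection {
  op_fun :> E -> E;
  op_proof : is_order_projection op_fun
}.

HB.instance Definition _ (p : order_projection) :=
  GRing.isLinear.Build R E E *:%R (op_fun p)
    (let: And3 lin _ _ := op_proof p in lin).

Implicit Types p q : order_projection.

Lemma op_idem p x : p (p x) = p x.
Proof. by case: (op_proof p). Qed.

Lemma op_bounds p x : 0 <= x -> 0 <= p x <= x.
Proof. by case: (op_proof p) => _ _; apply. Qed.

Lemma vl_subr_ge0 (x y : E) : (0 <= y - x) = (x <= y).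
Proof.
apply/idP/idP => h.
- by have := vl_leD2r _ _ x h; rewrite add0r subrK.
- by have := vl_leD2r _ _ (- x) h; rewrite subrr.
Qed.

Lemma vl_leUl (x y : E) : x <= vl_join x y.
Proof. by have := lexx (vl_join x y); rewrite vl_leUx => /andP[]. Qed.

Lemma vl_leUr (x y : E) : y <= vl_join x y.
Proof. by have := lexx (vl_join x y); rewrite vl_leUx => /andP[]. Qed.

Lemma eq_linear_ge0 (f g : {linear E -> E}) :
  (forall x : E, 0 <= x -> f x = g x) -> forall x, f x = g x.
Proof.
move=> fg x; pose u := vl_join x 0; pose v := u - x.
have u0 : 0 <= u by exact: vl_leUr.
have v0 : 0 <= v by rewrite vl_subr_ge0; exact: vl_leUl.
have -> : x = u - v by rewrite opprB addrC subrK.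
by move: (v) v0 => w w0; rewrite linearB linearB !fg.
Qed.

Lemma op_compl_subproof p : is_order_projection (fun x => x - p x).
Proof.
split.
- by move=> a x y; rewrite linearP scalerBr opprD addrACA.
- by move=> x; rewrite linearB /= op_idem subrr subr0.
- move=> x /(op_bounds p)/andP[px0 pxx]; rewrite vl_subr_ge0 pxx.
  by rewrite -vl_subr_ge0 opprB addrC subrK.
Qed.

Definition op_compl p := OrderProjection (op_compl_subproof p).

Lemma op_mul_compl0 p q x : q (p (op_compl q x)) = 0.
Proof.
suff : forall x, (q \o p \o op_compl q) x = (\0 : E -> E) x by apply.
apply: eq_linear_ge0 => {}x x0; change (q (p (op_compl q x)) = 0).
have qc0 : q (op_compl q x) = 0 by rewrite /= linearB /= op_idem subrr.
have /andP[c0 _] := op_bounds (op_compl q) x0.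
move: (op_compl q x) qc0 c0 => c qc0 c0.
have /andP[pc0 pc] := op_bounds p c0.
have /andP[qpc0 _] := op_bounds q pc0.
apply/le_anti; rewrite qpc0 andbT.
have : 0 <= c - p c by rewrite vl_subr_ge0.
by move=> /(op_bounds q)/andP[+ _]; rewrite linearB vl_subr_ge0 /= qc0.
Qed.

Lemma op_comm p q x : p (q x) = q (p x).
Proof.
have qpq : q (p x) = q (p (q x)).
  apply/eqP; rewrite -subr_eq0 -!linearB; apply/eqP; exact: op_mul_compl0.
rewrite qpq; apply/eqP; rewrite -subr_eq0; apply/eqP.
have := op_mul_compl0 p (op_compl q) x.
by rewrite /= opprB (addrC x) subrK.
Qed.

Lemma op_meet_subproof p q : is_order_projection (fun x => p (q x)).
Proof.
split.
- by move=> a x y; rewrite !linearP.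
- by move=> x; rewrite (op_comm q p) op_idem op_idem.
- move=> x /(op_bounds q)/andP[qx0 qxx].
  have /andP[-> pqx] := op_bounds p qx0; exact: le_trans pqx qxx.
Qed.

Definition op_meet p q := OrderProjection (op_meet_subproof p q).

Lemma op_join_subproof p q : is_order_projection (fun x => p x + q x - p (q x)).
Proof.
have -> : (fun x => p x + q x - p (q x)) =
          op_compl (op_meet (op_compl p) (op_compl q)).
  apply/funext => x /=.
  by rewrite !opprD !opprK !addrA subrr add0r linearB addrCA addrA.
exact: op_proof.
Qed.

Definition op_join p q := OrderProjection (op_join_subproof p q).

End OrderProjections.

Arguments order_projection {R} E.

Definition boolean_homomorphism (R : realType) (E F : vectorLatticeType R)
    (Phi : order_projection E -> order_projection F) : Prop :=
  [/\ forall p q, Phi (op_join p q) = op_join (Phi p) (Phi q),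
      forall p q, Phi (op_meet p q) = op_meet (Phi p) (Phi q) &
      forall p, Phi (op_compl p) = op_compl (Phi p)].

(* A map [D -> F] is represented by a total function [T : E -> F] of which only
   the values on [D] are ever used. *)
Section MapsOnLateralIdeals.
Variables (R : realType) (E F : vectorLatticeType R).
Implicit Types (D : set E) (T : E -> F).

Definition orthogonally_additive D T : Prop :=
  forall x y, D x -> D y -> disjoint_elts x y -> T (x + y) = T x + T y.

Definition positive_on D T : Prop := forall x, D x -> 0 <= T x.

Definition atomic (Phi : order_projection E -> order_projection F) D T : Prop :=
  forall (p : order_projection E) x, D x -> T (p x) = Phi p (T x).

Definition fragment_values D T (x : E) : set F :=
  T @` (fragments x `&` D).

(* [supremum 0] is the least upper bound when there is one, and [0] on the empty
   set; its value on a set without supremum is meaningless, so that the formula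
   defines an operator only under [minimal_extension_defined]. *)
Definition minimal_extension D T (x : E) : F :=
  supremum 0 (fragment_values D T x).

(* For Dedekind complete [F] this says exactly that every supremum in the formula
   exists. It does not follow from positivity, orthogonal additivity and
   atomicity: take [E] the space of all real sequences, [F] the bounded ones,
   [D] the finitely supported ones, [T y = (n * |y_n|)_n] and [Phi] the
   canonical isomorphism; the values on fragments of [(1, 1, ...)] are
   unbounded in [F]. *)
Definition minimal_extension_defined D T : Prop :=
  forall x, has_ubound (fragment_values D T x).

End MapsOnLateralIdeals.

(* Main.v *)
Require Import Defs.
From HB Require Import structures.
From mathcomp Require Import all_boot all_order all_algebra.
From mathcomp Require Import boolp classical_sets reals.

Import Order.TTheory GRing.Theory Num.Theory.

Local Open Scope classical_set_scope.
Local Open Scope ring_scope.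

(** Fragments of [p x] are exactly the [p y] with [y] a fragment of [x], so by
    atomicity of [T] the values on the fragments of [p x] are the image under
    [Phi p] of the values on the fragments of [x]; order projections preserve
    suprema of sets of positive elements, hence the extension is atomic.
    Orthogonal additivity is then a consequence of atomicity: for [x] disjoint
    from [y], the projection [p] onto the band generated by [x] satisfies
    [p (x + y) = x] and [(Id - p) (x + y) = y], and [Phi (Id - p)] is
    [Id - Phi p]. *)

(** * Order arithmetic, absolute values and disjointness *)

Section VectorLatticeArithmetic.
Context {R : realType} {E : vectorLatticeType R}.
Implicit Types (x y z u v w : E).

Lemma vl_lerD x y z w : x <= y -> z <= w -> x + z <= y + w.
Proof.
move=> xy zw; apply: le_trans (vl_leD2r _ _ z xy) _.
by rewrite (addrC y z) (addrC y w); exact: vl_leD2r.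
Qed.

Lemma vl_lerBlDr x y z : (x - y <= z) = (x <= z + y).
Proof. by rewrite -(vl_subr_ge0 (x - y)) -(vl_subr_ge0 x) opprB addrA. Qed.

Lemma vl_lerN2 x y : (- x <= - y) = (y <= x).
Proof. by rewrite -(vl_subr_ge0 (- x)) -(vl_subr_ge0 y) opprK addrC. Qed.

Lemma vl_lerBr x y : (x <= x - y) = (y <= 0).
Proof. by rewrite -(vl_lerN2 (x - y) x) opprB vl_lerBlDr addNr. Qed.

Lemma vl_ler_wpZ (a : R) x y : 0 <= a -> x <= y -> a *: x <= a *: y.
Proof.
by move=> a0 xy; rewrite -vl_subr_ge0 -scalerBr vl_scale_ge0 ?vl_subr_ge0.
Qed.

Lemma vl_leIl x y : vl_meet x y <= x.
Proof. by have := lexx (vl_meet x y); rewrite vl_lexI => /andP[]. Qed.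

Lemma vl_leIr x y : vl_meet x y <= y.
Proof. by have := lexx (vl_meet x y); rewrite vl_lexI => /andP[]. Qed.

Lemma vl_meetC x y : vl_meet x y = vl_meet y x.
Proof. by apply: le_anti; rewrite !vl_lexI !vl_leIl !vl_leIr. Qed.

Lemma vl_ler_abs x : x <= vl_abs x.
Proof. exact: vl_leUl. Qed.

Lemma vl_lerN_abs x : - x <= vl_abs x.
Proof. exact: vl_leUr. Qed.

Lemma vl_abs_le x u : (vl_abs x <= u) = (x <= u) && (- x <= u).
Proof. exact: vl_leUx. Qed.

Lemma vl_abs_ge0 x : 0 <= vl_abs x.
Proof.
have := vl_lerD _ _ _ _ (vl_ler_abs x) (vl_lerN_abs x).
rewrite subrr -mulr2n -scaler_nat => h.
have := vl_scale_ge0 2^-1 _ (ltW _) h.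
by rewrite scalerA mulVf ?pnatr_eq0// scale1r; apply; rewrite invr_gt0 ltr0n.
Qed.

Lemma vl_absN x : vl_abs (- x) = vl_abs x.
Proof.
have absN_le y : vl_abs (- y) <= vl_abs y.
  by rewrite vl_abs_le opprK vl_ler_abs vl_lerN_abs.
by apply: le_anti; rewrite absN_le -{1}(opprK x) absN_le.
Qed.

Lemma vl_abs_le0 x : vl_abs x <= 0 -> x = 0.
Proof.
rewrite vl_abs_le -{2}oppr0 vl_lerN2 => h; exact: le_anti.
Qed.

Lemma vl_abs0 : vl_abs (0 : E) = 0.
Proof. by apply: le_anti; rewrite vl_abs_ge0 vl_abs_le oppr0 lexx. Qed.

Lemma vl_absD x y : vl_abs (x + y) <= vl_abs x + vl_abs y.
Proof. by rewrite vl_abs_le opprD !vl_lerD ?vl_ler_abs ?vl_lerN_abs. Qed.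

Lemma vl_absZ_le (a t : R) x : `|a| <= t -> vl_abs (a *: x) <= t *: vl_abs x.
Proof.
have pos b y : 0 <= b -> b <= t -> b *: y <= t *: vl_abs y.
  move=> b0 bt; apply: le_trans (vl_ler_wpZ _ _ _ b0 (vl_ler_abs y)) _.
  by rewrite -vl_subr_ge0 -scalerBl vl_scale_ge0 ?subr_ge0 ?vl_abs_ge0.
move=> at_; rewrite vl_abs_le -scalerN.
have [a0|a0] := leP 0 a.
  have at' : a <= t by rewrite -(ger0_norm a0).
  by rewrite -{2}(vl_absN x) !pos.
have at' : - a <= t by rewrite -(ltr0_norm a0).
have na0 : 0 <= - a by rewrite oppr_ge0 ltW.
rewrite [X in _ && X](_ : _ = (- a *: x <= t *: vl_abs x)); last first.
  by rewrite scalerN scaleNr.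
by rewrite -(opprK a) scaleNr -scalerN -{1}(vl_absN x) opprK !pos.
Qed.

(** Absolute values are nonnegative, hence so is their meet, and only its upper bound is at stake.
    Quantifying over common lower bounds keeps lattice identities out of the proofs below. *)
Lemma disjoint_eltsP x y :
  (forall w, w <= vl_abs x -> w <= vl_abs y -> w <= 0) <-> disjoint_elts x y.
Proof.
split=> [h|xy w wx wy]; last by rewrite -xy vl_lexI wx.
apply: le_anti; rewrite vl_lexI !vl_abs_ge0 andbT h ?vl_leIl//.
exact: vl_leIr.
Qed.

Lemma disjoint_elts_sym x y : disjoint_elts x y -> disjoint_elts y x.
Proof. by rewrite /disjoint_elts vl_meetC. Qed.

Lemma disjoint_elts0 x : disjoint_elts 0 x.
Proof. by apply/disjoint_eltsP => w; rewrite vl_abs0. Qed.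

Lemma disjoint_elts_self x : disjoint_elts x x -> x = 0.
Proof. by move=> /disjoint_eltsP h; apply/vl_abs_le0/h. Qed.

Lemma disjoint_elts_le x y x' y' : disjoint_elts x y ->
  vl_abs x' <= vl_abs x -> vl_abs y' <= vl_abs y -> disjoint_elts x' y'.
Proof.
move=> /disjoint_eltsP xy xx yy; apply/disjoint_eltsP => w wx wy.
by apply: xy; [exact: le_trans xx|exact: le_trans yy].
Qed.

(** As [y] is nonnegative, [w - y] lies below both [x] and [z]; hence [w <= y], and the assumption
    on [y] and [z] applies. *)
Lemma meet_le0D x y z : 0 <= y -> (forall w, w <= x -> w <= z -> w <= 0) ->
  (forall w, w <= y -> w <= z -> w <= 0) ->
  forall w, w <= x + y -> w <= z -> w <= 0.
Proof.
move=> y0 xz yz w wxy wz; apply: (yz) => //.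
suff : w - y <= 0 by rewrite vl_lerBlDr add0r.
apply: xz; rewrite vl_lerBlDr //.
by rewrite -[w]addr0 vl_lerD.
Qed.

Lemma disjoint_eltsDl x y z :
  disjoint_elts x z -> disjoint_elts y z -> disjoint_elts (x + y) z.
Proof.
move=> /disjoint_eltsP xz /disjoint_eltsP yz; apply/disjoint_eltsP => w wxy.
apply: (meet_le0D _ _ _ (vl_abs_ge0 y) xz yz).
exact: le_trans (vl_absD _ _).
Qed.

Lemma disjoint_eltsDr x y z :
  disjoint_elts z x -> disjoint_elts z y -> disjoint_elts z (x + y).
Proof.
by move=> /disjoint_elts_sym zx /disjoint_elts_sym zy;
  exact/disjoint_elts_sym/disjoint_eltsDl.
Qed.

Lemma disjoint_eltsZl (a : R) x y :
  disjoint_elts x y -> disjoint_elts (a *: x) y.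
Proof.
move=> /disjoint_eltsP xy; apply/disjoint_eltsP => w wx wy.
(* It dominates the modulus of [a], which puts [t^-1 *: w] below [vl_abs x], and it is at least 1,
   which keeps [t^-1 *: w] below [vl_abs y]. *)
pose t := `|a| + 1; have t1 : 1 <= t by rewrite lerDr.
have t0 : 0 < t by exact: lt_le_trans t1.
have tV0 : 0 <= t^-1 by rewrite invr_ge0 ltW.
have scaleK z : t^-1 *: (t *: z) = z by rewrite scalerA mulVf ?gt_eqF// scale1r.
have : t^-1 *: w <= 0.
  apply: xy.
    rewrite -(scaleK (vl_abs x)); apply: vl_ler_wpZ => //.
    by apply: le_trans wx (vl_absZ_le _ _ _ _); rewrite lerDl.
  apply: le_trans (vl_ler_wpZ _ _ _ tV0 wy) _.
  rewrite -vl_subr_ge0 -{1}[vl_abs y]scale1r -scalerBl vl_scale_ge0 ?vl_abs_ge0//.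
  by rewrite subr_ge0 invf_le1.
move=> /(vl_ler_wpZ _ _ _ (ltW t0)).
by rewrite scaler0 scalerA mulfV ?gt_eqF// scale1r.
Qed.

Lemma disjoint_eltsNl x y : disjoint_elts x y -> disjoint_elts (- x) y.
Proof. by rewrite /disjoint_elts vl_absN. Qed.

(** The element [x + y - u] is a common lower bound of [x] and [y]. *)
Lemma meet_le0_add_le x y u : (forall w, w <= x -> w <= y -> w <= 0) ->
  x <= u -> y <= u -> x + y <= u.
Proof.
move=> xy xu yu; rewrite -[u]add0r -vl_lerBlDr; apply: xy.
  by rewrite vl_lerBlDr vl_lerD.
by rewrite vl_lerBlDr addrC vl_lerD.
Qed.

(** The positive and negative parts of [s] are treated separately: the first by minimality of [s],
    the second because it is dominated by the absolute value of any element of [A]. *)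
Lemma disjoint_elts_supremum (A : set E) s y :
  (forall a, A a -> disjoint_elts a y) -> supremums A s -> disjoint_elts s y.
Proof.
move=> Ay [ubs lubs]; have [[a0 Aa0]|] := pselect (A !=set0); last first.
  (* An ordered group with a least element is trivial. *)
  move=> A0; have ub z : s <= z by apply: lubs => a Aa; case: A0; exists a.
  suff -> : s = 0 by exact: disjoint_elts0.
  apply: vl_abs_le0; rewrite vl_abs_le ub -oppr0 vl_lerN2.
  by have := ub (s + s); rewrite -(vl_subr_ge0 s) addrK.
pose sp := vl_join s 0; pose v := vl_meet sp (vl_abs y).
have sp0 : 0 <= sp by exact: vl_leUr.
have ssp : s <= sp by exact: vl_leUl.
(* The two parts of [s] are disjoint, since [sp - w] bounds both [s] and [0]. *)
have sp_sn w : w <= sp -> w <= sp - s -> w <= 0.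
  move=> w1 w2; rewrite -(vl_lerBr sp).
  by rewrite vl_leUx vl_subr_ge0 w1 andbT -vl_subr_ge0 addrAC vl_subr_ge0.
(* It suffices that [s - v] still bounds [A]. *)
have v0 : v <= 0.
  rewrite -(vl_lerBr s).
  apply: lubs => a Aa; have as_ : a <= s by exact: ubs.
  have aspv : vl_join a 0 + v <= sp.
    apply: meet_le0_add_le; last exact: vl_leIl.
    - move=> w wa wv; have /disjoint_eltsP := Ay a Aa; apply.
        by apply: le_trans wa _; rewrite vl_leUx vl_ler_abs vl_abs_ge0.
      exact: le_trans wv (vl_leIr _ _).
    - by rewrite vl_leUx sp0 (le_trans as_).
  (* Both summands lie below [sp - a] and their meet is at most [0]; cancelling [sp] then yields
     [a <= s - v]. *)
  have : v + (sp - s) <= sp - a.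
    apply: meet_le0_add_le.
    - by move=> w wv; apply: sp_sn; apply: le_trans wv (vl_leIl _ _).
    - rewrite -vl_subr_ge0 -addrA -opprD vl_subr_ge0; apply: le_trans aspv.
      by rewrite vl_lerD ?vl_leUl.
    - by rewrite vl_lerD ?vl_lerN2.
  rewrite -(vl_subr_ge0 (v + _)) -(vl_subr_ge0 a).
  rewrite opprD opprB !addrA -!(addrA sp) (addrC sp) subrK.
  by rewrite [- a - v + s]addrC (addrC (- a)) addrA.
apply/disjoint_eltsP => w ws.
have sE : vl_abs s <= sp + (sp - s).
  rewrite vl_abs_le -{1}[s]addr0 vl_lerD ?vl_subr_ge0//=.
  by rewrite addrA -{1}[- s]add0r vl_lerD// -[0]addr0 vl_lerD.
have wsp := le_trans ws sE; apply: meet_le0D wsp.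
- by rewrite vl_subr_ge0.
- by move=> w' ? ?; apply: le_trans v0; rewrite vl_lexI; apply/andP.
- move=> w' w's w'y; have /disjoint_eltsP := Ay _ Aa0; apply => //.
  apply: le_trans w's _; rewrite vl_lerBlDr vl_leUx.
  rewrite -{1}[s]add0r vl_lerD ?vl_abs_ge0//=.
  rewrite -[s]opprK vl_subr_ge0; apply: le_trans (vl_lerN_abs a0).
  by rewrite vl_lerN2 ubs.
Qed.

Lemma band_disjoint_elts y : band [set x : E | disjoint_elts x y].
Proof.
split; last by move=> A x Ay /disjoint_elts_supremum; apply.
split => [|x z|a x|x z] /=.
- exact: disjoint_elts0.
- exact: disjoint_eltsDl.
- exact: disjoint_eltsZl.
- by move=> xy zx; exact: disjoint_elts_le xy zx (lexx _).
Qed.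

(** The elements disjoint from [y] form one of the bands intersected in [band_generated x]. *)
Lemma disjoint_complement_band_generated x y :
  disjoint_elts x y -> disjoint_complement (band_generated x) y.
Proof.
move=> xy z /(_ [set w | disjoint_elts w y]) zy; apply: disjoint_elts_sym.
by apply: zy; split=> //; exact: band_disjoint_elts.
Qed.

Lemma band_generated_self x : band_generated x x.
Proof. by move=> B []. Qed.

End VectorLatticeArithmetic.

(** * The order projection onto a projection band *)

Section BandProjection.
Context {R : realType} {E : vectorLatticeType R}.
Variable B : set E.
Hypothesis B_proj : projection_band B.

Let decomposition x :
  {y | exists z, [/\ B y, disjoint_complement B z & x = y + z]}.
Proof. by apply: cid; case: B_proj => _ /(_ x). Qed.

Definition band_proj x : E := sval (decomposition x).

Lemma band_proj_in x : B (band_proj x).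
Proof. by rewrite /band_proj; case: decomposition => y [z []]. Qed.

Lemma band_proj_compl x : disjoint_complement B (x - band_proj x).
Proof.
rewrite /band_proj; case: decomposition => y [z [_ Bz xE]] /=.
by rewrite xE addrAC subrr add0r.
Qed.

(** The difference of two candidates lies in [B] and is disjoint from all of [B], hence from itself.
    Linearity and idempotence of the chosen component follow from this. *)
Lemma band_proj_unique x y :
  B y -> disjoint_complement B (x - y) -> band_proj x = y.
Proof.
case: B_proj => -[[_ BD BZ _] _] _ By xy.
apply/eqP; rewrite -subr_eq0; apply/eqP/disjoint_elts_self.
have BB : B (band_proj x - y).
  by rewrite -scaleN1r; apply: BD; [exact: band_proj_in|exact: BZ].
rewrite -{1}[band_proj x](addrNK x) -addrA; apply: disjoint_eltsDl.
  by rewrite -opprB; apply: disjoint_eltsNl; exact: band_proj_compl.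
exact: xy.
Qed.

Lemma band_proj_is_order_projection : is_order_projection band_proj.
Proof.
case: (B_proj) => -[[B0 BD BZ _] _] _; split.
- move=> a x y; apply: band_proj_unique.
    by apply: BD; [apply: BZ|]; exact: band_proj_in.
  rewrite opprD addrACA -scalerBr => z Bz; apply: disjoint_eltsDl.
    by apply: disjoint_eltsZl; exact: band_proj_compl.
  exact: band_proj_compl.
- move=> x; apply: band_proj_unique; first exact: band_proj_in.
  by rewrite subrr => z _; exact: disjoint_elts0.
- move=> x x0; have := band_proj_compl x _ (band_proj_in x).
  move: (band_proj x) => y /disjoint_eltsP d.
  (* Both [- y] and, further on, [y - x] are common lower bounds of [vl_abs y] and
     [vl_abs (x - y)]. *)
  have y0 : 0 <= y.
    rewrite -[y]opprK -oppr0 vl_lerN2; apply: d (vl_lerN_abs _).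
    apply: le_trans (vl_ler_abs _).
    by rewrite -vl_subr_ge0 opprK subrK.
  rewrite y0 -vl_subr_ge0 -[x - y]opprK -oppr0 vl_lerN2.
  apply: d; first exact: vl_lerN_abs.
  by apply: le_trans (vl_ler_abs _); rewrite opprB vl_lerBlDr -{1}[y]addr0 vl_lerD.
Qed.

Definition band_projection : order_projection E :=
  OrderProjection band_proj_is_order_projection.

End BandProjection.

Lemma exists_separating_projection (R : realType) (E : vectorLatticeType R)
    (x y : E) : principal_projection_property E -> disjoint_elts x y ->
  exists p : order_projection E, p (x + y) = x.
Proof.
move=> ppp xy; exists (band_projection _ (ppp x)).
apply: band_proj_unique; first exact: band_generated_self.
by rewrite addrAC subrr add0r; exact: disjoint_complement_band_generated.
Qed.

(** * Order projections acting on fragments and on suprema *)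

Section OrderProjectionFragments.
Context {R : realType} {E : vectorLatticeType R}.
Implicit Types (p : order_projection E) (x y : E).

Lemma op_ge0 p x : 0 <= x -> 0 <= p x.
Proof. by move=> /(op_bounds p)/andP[]. Qed.

Lemma op_le p x : 0 <= x -> p x <= x.
Proof. by move=> /(op_bounds p)/andP[]. Qed.

Lemma op_homo p x y : x <= y -> p x <= p y.
Proof. by rewrite -(vl_subr_ge0 x) -(vl_subr_ge0 (p x)) -linearB; exact: op_ge0. Qed.

Lemma op_compl_op p x : op_compl p (p x) = 0.
Proof. by rewrite /= op_idem subrr. Qed.

Lemma op_op_compl p x : p (op_compl p x) = 0.
Proof. by rewrite /= linearB /= op_idem subrr. Qed.

Lemma op_decomp p x : x = p x + op_compl p x.
Proof. by rewrite /= addrC subrK. Qed.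

Lemma vl_abs_op p x : vl_abs (p x) <= p (vl_abs x).
Proof.
by rewrite vl_abs_le -linearN !op_homo ?vl_ler_abs ?vl_lerN_abs.
Qed.

Lemma vl_abs_op_le p x : vl_abs (p x) <= vl_abs x.
Proof. exact: le_trans (vl_abs_op _ _) (op_le _ _ (vl_abs_ge0 _)). Qed.

(** A common lower bound [w] splits as [p w + op_compl p w]; each term is at most [0], because [p]
    and [op_compl p] annihilate each other's range. *)
Lemma disjoint_op_compl p x y : disjoint_elts (p x) (op_compl p y).
Proof.
apply/disjoint_eltsP => w wx wy; rewrite [w](op_decomp p) -[0]addr0.
apply: vl_lerD.
  by rewrite -(op_op_compl p (vl_abs y)) op_homo// (le_trans wy)// vl_abs_op.
by rewrite -(op_compl_op p (vl_abs x)) op_homo// (le_trans wx)// vl_abs_op.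
Qed.

Lemma fragments_op p x : fragments x (p x).
Proof. exact: disjoint_op_compl. Qed.

Lemma op_fragments p x y : fragments x y -> fragments (p x) (p y).
Proof.
move=> yx; rewrite /fragments /= -linearB.
by apply: disjoint_elts_le yx _ _; exact: vl_abs_op_le.
Qed.

(** As [op_compl p] kills [p x], the element [y - p y] is dominated by both [y] and [p x - y], so it
    is disjoint from itself. *)
Lemma fragments_op_id p x y : fragments (p x) y -> p y = y.
Proof.
move=> yx; apply/esym/eqP; rewrite -subr_eq0; apply/eqP.
apply: disjoint_elts_self; apply: disjoint_elts_le yx _ _.
  exact: (vl_abs_op_le (op_compl p)).
rewrite -[y - p y]/(op_compl p y) -vl_absN -[- _]add0r -(op_compl_op p x).
by rewrite -linearB; exact: vl_abs_op_le.
Qed.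

(** Here [x - y] is [p x - y] plus [op_compl p x], and the latter is disjoint from [y = p y]. *)
Lemma fragments_op_sub p x : fragments (p x) `<=` fragments x.
Proof.
move=> y yx; rewrite /fragments /= (op_decomp p x) addrAC.
apply: disjoint_eltsDr => //.
by rewrite -(fragments_op_id _ _ _ yx); exact: disjoint_op_compl.
Qed.

(** If [u] bounds the image, then [p u + op_compl p s] bounds [A], hence [s]; applying [p] gives
    [p s <= p u]. A positive element of [A] makes [u] nonnegative, whence [p u <= u]. *)
Lemma op_supremums p (A : set E) s : A !=set0 -> (forall a, A a -> 0 <= a) ->
  supremums A s -> supremums (p @` A) (p s).
Proof.
move=> [a0 Aa0] A_ge0 [ubs lubs]; split => [_ [a Aa <-]|u ubu].
  by apply: op_homo; exact: ubs.
have u0 : 0 <= u.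
  by apply: le_trans (ubu (p a0) _); [exact/op_ge0/A_ge0|exists a0].
suff : s <= p u + op_compl p s.
  move=> /(op_homo p); rewrite linearD /= op_idem.
  rewrite -/(op_compl p s) op_op_compl addr0 => /le_trans; apply.
  exact: op_le.
apply: lubs => a Aa; rewrite [a](op_decomp p); apply: vl_lerD.
  by rewrite -op_idem; apply: op_homo; apply: ubu; exists a.
by apply: op_homo; exact: ubs.
Qed.

End OrderProjectionFragments.

(** * Suprema over fragments and the minimal extension *)

Lemma fragments0 (R : realType) (E : vectorLatticeType R) (x : E) :
  fragments x 0.
Proof. exact: disjoint_elts0. Qed.

Lemma orthogonally_additive0 (R : realType) (E F : vectorLatticeType R)
    (D : set E) (T : E -> F) :
  orthogonally_additive D T -> D 0 -> T 0 = 0.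
Proof.
move=> T_oa D0; apply: (addrI (T 0)).
by rewrite -T_oa ?addr0//; exact: disjoint_elts0.
Qed.

Lemma supremums_supremum (R : realType) (F : vectorLatticeType R) (A : set F) :
  dedekind_complete F -> A !=set0 -> has_ubound A ->
  supremums A (supremum 0 A).
Proof.
move=> dc A0 ubA; rewrite /supremum; case: eqP => [A_eq0|_].
  by case: A0 => a; rewrite A_eq0.
by have [s sA] := dc A A0 ubA; exact: xgetI sA.
Qed.

(** A fragment [y] of [p x] serves as its own preimage, being fixed by [p]. Conversely, [p y] stays
    in [D] as a fragment of [y]. *)
Lemma fragment_values_op (R : realType) (E F : vectorLatticeType R)
    (Phi : order_projection E -> order_projection F) (D : set E) (T : E -> F)
    (p : order_projection E) (x : E) :
  lateral_ideal D -> atomic Phi D T ->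
  fragment_values D T (p x) = Phi p @` fragment_values D T x.
Proof.
move=> [D_frag _] T_at; apply/seteqP; split.
  move=> _ [y [yx Dy] <-]; exists (T y).
    by exists y => //; split => //; exact: fragments_op_sub yx.
  by rewrite -T_at // (fragments_op_id _ _ _ yx).
move=> _ [_ [y [yx Dy] <-] <-]; rewrite -T_at //.
exists (p y) => //; split; first exact: op_fragments.
exact: D_frag Dy (fragments_op _ _).
Qed.

Theorem theorem4p7 (R : realType) (E F : vectorLatticeType R)
  (E_arch : vl_archimedean E)
  (E_ppp : principal_projection_property E)
  (F_dc : dedekind_complete F)
  (Phi : order_projection E -> order_projection F)
  (Phi_hom : boolean_homomorphism Phi)
  (D : set E) (D_lat : lateral_ideal D)
  (T : E -> F)
  (T_atomic : atomic Phi D T)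
  (T_pos : positive_on D T)
  (T_oa : orthogonally_additive D T)
  (T_ext : minimal_extension_defined D T) :
  [/\ atomic Phi setT (minimal_extension D T),
      positive_on setT (minimal_extension D T) &
      orthogonally_additive setT (minimal_extension D T)].
Proof.
have V_ge0 x a : fragment_values D T x a -> 0 <= a.
  by move=> [y [_ Dy] <-]; exact: T_pos.
have V0 x : D !=set0 -> fragment_values D T x 0.
  move=> [d Dd]; have D0 : D 0 by apply: (proj1 D_lat) Dd _; exact: fragments0.
  exists 0; last exact: orthogonally_additive0 T_oa D0.
  by split=> //; exact: fragments0.
have ext_sup x : D !=set0 ->
    supremums (fragment_values D T x) (minimal_extension D T x).
  by move=> /(V0 x) h; apply: supremums_supremum => //; exists 0.
(* For empty [D] the default value [0] of [supremum] makes the extension the zero map. *)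
have ext_D0 x : ~ (D !=set0) -> minimal_extension D T x = 0.
  move=> D0; rewrite /minimal_extension (_ : fragment_values D T x = set0).
    exact: supremum0.
  by apply/seteqP; split => // t [y [_ Dy] _]; case: D0; exists y.
have ext_atomic : atomic Phi setT (minimal_extension D T).
  move=> p x _; have [D0|D0] := pselect (D !=set0); last first.
    by rewrite !ext_D0// linear0.
  have := ext_sup (p x) D0.
  rewrite (fragment_values_op _ _ _ _ _ _ _ _ D_lat T_atomic).
  (* Both sides are suprema of the same set, and suprema are unique. *)
  move=> h; apply: is_subset1_supremums h _.
  by apply: op_supremums; [exists 0; exact: V0|exact: V_ge0|exact: ext_sup].
split => //.
  move=> x _; have [D0|D0] := pselect (D !=set0); last by rewrite ext_D0.
  by case: (ext_sup x D0) => + _; apply; exact: V0.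
move=> x y _ _ xy; have [p px] := exists_separating_projection _ _ _ _ E_ppp xy.
have py : op_compl p (x + y) = y by rewrite /= px addrAC subrr add0r.
have [_ _ PhiC] := Phi_hom.
(* The value at [x + y] splits along [Phi p]; atomicity moves both projections inside, where they
   select [x] and [y]. *)
rewrite [LHS](op_decomp (Phi p)) -PhiC -!ext_atomic ?px ?py //.
Qed.
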